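(* Let $G$ be a finite graph (loopless, multiple edges allowed), let $m$ be a positive integer, and let $T$ be an $m$-tree-connected factor of $G$. If $F$ is a factor of $G$, then $G$ has an $m$-tree-connected factor $H$ such that for each vertex $v$, $$d_F(v)\le d_H(v)\le d_T(v)+\max\{0,d_F(v)-m\}.$$
   Context: A factor is a spanning subgraph; $d_X(v)$ is the number of edges of $X$ incident to $v$. A graph is $m$-tree-connected if it contains $m$ edge-disjoint spanning trees. *)

(* Defs.v *)
From HB Require Import structures.
From mathcomp Require Import all_boot.

Set Implicit Arguments.
Unset Strict Implicit.
Unset Printing Implicit Defensive.

(* Edges are objects of their own, so distinct edges may share both endpoints;
   [ends_card] excludes loops. *)
Record mgraph := MGraph {
  vertex : finType;
  edge : finType;
  ends : edge -> {set vertex};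
  ends_card : forall e, #|ends e| = 2
}.

Section Factors.

Variable G : mgraph.

(* A factor keeps all vertices, so it is determined by its set of edges. *)
Definition factor := {set edge G}.

Implicit Types (A : factor) (x y v : vertex G).

Definition deg A v : nat := #|[set e in A | v \in ends e]|.

Definition adj A : rel (vertex G) :=
  fun x y => [exists e in A, ends e == [set x; y]].

Definition is_connected A : Prop := forall x y, connect (adj A) x y.

(* [walk A x p]: from x, each (e, y) in p moves along the edge e to y. *)
Fixpoint walk A x (p : seq (edge G * vertex G)) : bool :=
  if p is (e, y) :: p' then
    [&& e \in A, ends e == [set x; y] & walk A y p']
  else true.

(* Since there are no loops, a cycle has length at least 2; length 2 is a pair
   of parallel edges. *)
Definition is_cycle A x (p : seq (edge G * vertex G)) : bool :=
  [&& p != [::], walk A x p, last x (unzip2 p) == x,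
      uniq (unzip1 p) & uniq (unzip2 p)].

Definition acyclic A : Prop := forall x p, ~~ is_cycle A x p.

Definition spanning_tree A : Prop := is_connected A /\ acyclic A.

Definition tree_connected (m : nat) A : Prop :=
  exists t : 'I_m -> factor,
    [/\ forall i, t i \subset A,
        forall i, spanning_tree (t i)
      & forall i j, i != j -> [disjoint t i & t j]].

End Factors.

(* Main.v *)
Require Import Defs.
From HB Require Import structures.
From mathcomp Require Import all_boot zify.

Set Implicit Arguments.
Unset Strict Implicit.
Unset Printing Implicit Defensive.

(** Call a vertex big if its degree in [F] exceeds [m].  An edge of [F]
    outside [T] joining two big vertices can be deleted from [F] and added
    back to the [H] obtained for the smaller factor, as both bounds then rise
    by one at its ends.  Once there is no such edge, start with [H = T] and
    repair the vertices [v] with [d_H(v) < d_F(v)].  Such a [v] is big, because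
    [d_H(v) >= m], so an edge [vw] of [F] missing from [H] has [w] not big.  In
    each of the [m] trees, the first edge of the path from [w] to [v] can be
    exchanged for [vw].  As [vw] is one of the at most [m] edges of [F] at [w],
    one of these [m] first edges is not in [F].  Exchanging it raises
    no degree but that of [v], and [H] gains an edge of [F]. *)

Section Packing.

Variable G : mgraph.

Implicit Types (A B H F T : factor G) (e g : edge G) (v w x y : vertex G).

(** * Degrees and adjacency *)

Lemma degE A v : deg A v = \sum_(e in A) (v \in ends e).
Proof.
rewrite /deg -sum1_card [RHS]big_mkcond [LHS]big_mkcond.
by apply: eq_bigr => e _; rewrite inE; case: (e \in A); case: (v \in ends e).
Qed.

Lemma deg_setU1 A e v : e \notin A -> deg (e |: A) v = (v \in ends e) + deg A v.
Proof. by move=> eA; rewrite !degE big_setU1. Qed.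

Lemma deg_setD1 A e v : e \in A -> deg A v = (v \in ends e) + deg (A :\ e) v.
Proof. by move=> eA; rewrite !degE (big_setD1 e). Qed.

Lemma deg_subset A B v : A \subset B -> deg A v <= deg B v.
Proof.
move=> sAB; apply: subset_leq_card; apply/subsetP => e.
by rewrite !inE => /andP[eA ->]; rewrite (subsetP sAB).
Qed.

Lemma ends_other e w : w \in ends e -> exists v, ends e = [set v; w].
Proof.
have /eqP/cards2P[x [y [_ ->]]] := ends_card e.
rewrite !inE => /orP[]/eqP->; last by exists x.
by exists y; rewrite setUC.
Qed.

Lemma ends_neq e v w : ends e = [set v; w] -> v != w.
Proof. by move=> E; have := ends_card e; rewrite E cards2; case: eqP. Qed.

Lemma adjP A x y :
  reflect (exists2 e, e \in A & ends e = [set x; y]) (adj A x y).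
Proof.
apply: (iffP existsP) => [[e /andP[eA /eqP E]]|[e eA E]]; exists e => //.
by rewrite eA E eqxx.
Qed.

Lemma adj_sym A : symmetric (adj A).
Proof.
by move=> x y; apply/adjP/adjP => -[e eA E]; exists e; rewrite // E setUC.
Qed.

Lemma connect_adjC A x y : connect (adj A) x y = connect (adj A) y x.
Proof. apply: sym_connect_sym; exact: adj_sym. Qed.

(** * Connectivity and edge exchange *)

(** A path in [A] can be rerouted inside [B]: its edges other than [e] survive, and each use of [e]
    becomes a detour between [x] and [y]. *)
Lemma is_connected_replace A B e x y : A :\ e \subset B -> ends e = [set x; y] ->
  connect (adj B) x y -> is_connected A -> is_connected B.
Proof.
move=> sAB E cxy cA a b; apply: connect_sub (cA a b) => {}a {}b /adjP[f fA Ef].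
have [fe|nfe] := eqVneq f e; last first.
  by apply/connect1/adjP; exists f => //; apply: (subsetP sAB); rewrite !inE nfe.
have : (a \in [set x; y]) && (b \in [set x; y]).
  by rewrite -E -fe Ef !inE !eqxx orbT.
rewrite !inE => /andP[/orP[]/eqP-> /orP[]/eqP->] //.
by rewrite connect_adjC.
Qed.

Lemma walk_connect A x p : walk A x p -> connect (adj A) x (last x (unzip2 p)).
Proof.
elim: p x => [|[e y] p IHp] x /=; first by rewrite connect0.
case/and3P=> eA /eqP E /IHp; apply: connect_trans.
by apply/connect1/adjP; exists e.
Qed.

Lemma walk_setD1 A e x p : e \notin unzip1 p -> walk A x p -> walk (A :\ e) x p.
Proof.
elim: p x => [|[f y] p IHp] x //=; rewrite inE negb_or.
case/andP=> nef ep /and3P[fA -> wp]; rewrite !inE fA IHp //.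
by rewrite eq_sym nef.
Qed.

(** An inclusion-minimal connected [B] is acyclic: an edge of a cycle could be deleted, since the
    rest of the cycle still joins its ends. *)
Lemma connected_has_spanning_tree A :
  is_connected A -> exists2 B : factor G, B \subset A & spanning_tree B.
Proof.
pose P B := [forall x, forall y, connect (adj B) x y].
have PP B : reflect (is_connected B) (P B).
  apply: (iffP forallP) => cB x; last by apply/forallP => y.
  by move=> y; apply: (forallP (cB x)).
move=> /PP /minset_exists[B /minsetP[/PP cB minB] sBA]; exists B => //.
split=> // x [|[e y] p]; first by [].
apply/negP => /and5P[_ /= /and3P[eB /eqP E wp] /eqP xE /andP[ep _] _].
have cD : is_connected (B :\ e).
  apply: (is_connected_replace _ E _ cB) => //.
  rewrite connect_adjC; have := walk_connect (walk_setD1 ep wp).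
  by rewrite xE.
have /setP/(_ e) := minB _ (introT (PP _) cD) (subD1set _ _).
by rewrite !inE eqxx eB.
Qed.

(* [g] is the first edge of a simple path from [w] to [v]. *)
Lemma connected_exchange A e v w : is_connected A -> ends e = [set v; w] ->
  exists g, [/\ g \in A, w \in ends g & is_connected (e |: A :\ g)].
Proof.
move=> cA E; have /connectP[p0 pth vE] := cA w v.
case/shortenP: pth vE => -[|x p] pth Up _ /= vE.
  by have := ends_neq E; rewrite vE eqxx.
move: pth Up => /= /andP[/adjP[g gA Eg] pth] /andP[wp _].
have wg : w \in ends g by rewrite Eg !inE eqxx.
exists g; split=> //.
apply: (is_connected_replace _ Eg _ cA); first exact: subsetUr.
have wv : connect (adj (e |: A :\ g)) w v.
  by apply/connect1/adjP; exists e; rewrite ?setU11 // E setUC.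
apply: connect_trans wv _; rewrite connect_adjC vE.
(* The rest of the simple path never returns to [w], an end of [g], so none of its edges is [g]. *)
elim: p x pth wp {vE Eg} => [|y p IHp] x /=; first by rewrite connect0.
case/andP=> /adjP[f fA Ef] pth; rewrite inE negb_or => /andP[wx wp].
apply: connect_trans (IHp y pth wp); apply/connect1/adjP; exists f => //.
rewrite !inE fA andbT; apply/orP; right; apply/eqP => fg.
move: wg wp; rewrite -fg Ef !inE negb_or (negPf wx) /=.
by case: (w == y).
Qed.

(** * Packings of connected factors *)

(** Trees are relaxed to connected factors, so that an exchange has only connectivity to preserve;
    spanning trees are extracted at the end. *)
Definition packing m A : Prop :=
  exists t : 'I_m -> factor G,
    [/\ forall i, t i \subset A,
        forall i, is_connected (t i)
      & forall i j, i != j -> [disjoint t i & t j]].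

Lemma tree_connectedP m A : tree_connected m A <-> packing m A.
Proof.
split=> -[t [tA ct dt]]; first by exists t; split=> // i; case: (ct i).
have /fin_all_exists[u uP] i : exists B : factor G, B \subset t i /\ spanning_tree B.
  by have [B] := connected_has_spanning_tree (ct i); exists B.
exists u; split=> [i|i|i j /dt dij]; try by case: (uP i).
  by apply: subset_trans (tA i); case: (uP i).
have [[ui _] [uj _]] := (uP i, uP j).
exact: disjointWl ui (disjointWr uj dij).
Qed.

Lemma packing_subset m A B : A \subset B -> packing m A -> packing m B.
Proof.
move=> sAB [t [tA ct dt]]; exists t; split=> // i.
exact: subset_trans (tA i) sAB.
Qed.

(** The exchange is made in one class [t i] at a time. Disjointness of the classes makes [g]
    injective, and as [e] lies in no class, the modified class stays disjoint from the others. *)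
Lemma packing_exchange m A e v w : packing m A -> ends e = [set v; w] ->
  e \notin A ->
  exists g : 'I_m -> edge G,
    [/\ injective g, forall i, g i \in A, forall i, w \in ends (g i)
      & forall i, packing m (e |: A :\ g i)].
Proof.
move=> [t [tA ct dt]] E eA.
have /fin_all_exists[g gP] i : exists f,
    [/\ f \in t i, w \in ends f & is_connected (e |: t i :\ f)].
  exact: connected_exchange (ct i) E.
have gt i : g i \in t i by case: (gP i).
have nt i j f : f \in t i -> i != j -> f \notin t j.
  by move=> fi ij; rewrite (disjointFr (dt i j ij) fi).
exists g; split=> [i j gij|i|i|i].
- apply/eqP/negPn/negP => ij.
  by have := nt i j (g i) (gt i) ij; rewrite gij gt.
- exact: subsetP (tA i) _ (gt i).
- by case: (gP i).
exists (fun j => if j == i then e |: t i :\ g i else t j).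
have et j : e \notin t j by apply: contra eA => /(subsetP (tA j)).
have dU j : j != i -> [disjoint e |: t i :\ g i & t j].
  move=> ji; apply/pred0P => f /=; rewrite !inE.
  have [->|_] /= := eqVneq f e; first by rewrite (negPf (et j)).
  case fi: (f \in t i); last by rewrite andbF.
  by rewrite (negPf (nt i j f fi _)) ?andbF // eq_sym.
split=> [j|j|j k jk].
- have [_|ji] := eqVneq j i; first exact/setUS/setSD.
  apply/subsetP => f fj; rewrite !inE (subsetP (tA j) f fj) andbT.
  apply/orP; right; apply: contraTneq fj => ->.
  by apply: nt (gt i) _; rewrite eq_sym.
- by have [_|_] := eqVneq j i; [case: (gP i)|].
- have [ji|ji] := eqVneq j i; have [ki|ki] := eqVneq k i; last exact: dt.
  + by rewrite ji ki eqxx in jk.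
  + exact: dU.
  + by rewrite disjoint_sym; exact: dU.
Qed.

Lemma leq_card_incident m A (g : 'I_m -> edge G) w : injective g ->
  (forall i, g i \in A) -> (forall i, w \in ends (g i)) -> m <= deg A w.
Proof.
move=> injg gA gw; rewrite -[m]card_ord -(card_imset _ injg).
apply/subset_leq_card/subsetP => f /imsetP[i _ ->].
by rewrite inE gA gw.
Qed.

Lemma packing_deg m A e w :
  packing m A -> e \notin A -> w \in ends e -> m <= deg A w.
Proof.
move=> pA eA /ends_other[v E].
have [g [injg gA gw _]] := packing_exchange pA E eA.
exact: leq_card_incident gA gw.
Qed.

(** Pigeonhole: if all [m] exchangeable edges were in [F], then together with [e] they would give
    [w] degree above [m] in [F]. *)
Lemma packing_exchange_notin m A F e v w : packing m A -> ends e = [set v; w] ->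
  e \in F -> e \notin A -> deg F w <= m ->
  exists g, [/\ g \in A, g \notin F, w \in ends g & packing m (e |: A :\ g)].
Proof.
move=> pA E eF eA Fw.
have [g [injg gA gw pg]] := packing_exchange pA E eA.
have [gF|] := boolP [forall i, g i \in F]; last first.
  by case/forallPn=> i giF; exists (g i).
have mFe : m <= deg (F :\ e) w.
  apply: leq_card_incident injg _ gw => i; rewrite !inE (forallP gF) andbT.
  by apply: contraNneq eA => <-.
have ew : w \in ends e by rewrite E !inE eqxx orbT.
by move: Fw; rewrite (deg_setD1 w eF) ew; lia.
Qed.

(** * Degree bounds *)

Definition degree_bounded m T F H : Prop :=
  forall v, deg H v <= deg T v + (deg F v - m).

Lemma exchange_to_lower_bound m T F : packing m T ->
  (forall e v w, e \in F :\: T -> ends e = [set v; w] ->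
     m < deg F v -> deg F w <= m) ->
  exists H, [/\ packing m H, H \subset T :|: F, forall v, deg F v <= deg H v
    & degree_bounded m T F H].
Proof.
move=> pT smallF.
(* The invariant [T :&: F \subset H] puts every edge of [F] missing from [H] outside [T], where
   [smallF] applies. It persists because only edges outside [F] are removed. *)
suff main n H : #|F :\: H| <= n -> packing m H -> H \subset T :|: F ->
    T :&: F \subset H -> degree_bounded m T F H ->
  exists H', [/\ packing m H', H' \subset T :|: F,
    forall v, deg F v <= deg H' v & degree_bounded m T F H'].
  apply: (main _ T (leqnn _) pT (subsetUl _ _) (subsetIl _ _)) => v.
  exact: leq_addr.
elim: n H => [|n IHn] H Hn pH HTF TFH ubH.
  exists H; split=> // v; apply: deg_subset.
  by rewrite -setD_eq0 -cards_eq0 -leqn0.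
have [lb|] := boolP [forall v, deg F v <= deg H v].
  by exists H; split=> // v; exact: (forallP lb).
case/forallPn=> v; rewrite -ltnNge => defv.
have [e eF [eH ve]] : exists2 e, e \in F & e \notin H /\ v \in ends e.
  have : ~~ ([set e in F | v \in ends e] \subset [set e in H | v \in ends e]).
    by apply: contraL defv => /subset_leq_card; rewrite -leqNgt.
  case/subsetPn=> e; rewrite !inE => /andP[eF ve]; rewrite ve andbT => eH.
  by exists e.
have eT : e \notin T by apply: contra eH => eT; rewrite (subsetP TFH) ?inE ?eT.
have [w] := ends_other ve; rewrite setUC => E.
have Hv : m <= deg H v := packing_deg pH eH ve.
have Tv : m <= deg T v := packing_deg pT eT ve.
have Fw : deg F w <= m.
  by apply: (smallF e v w) => //; rewrite ?inE ?eT //; exact: leq_ltn_trans defv.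
have [g [gH gF wg pg]] := packing_exchange_notin pH E eF eH Fw.
apply: (IHn (e |: H :\ g)) => //.
- rewrite -ltnS (leq_trans _ Hn) //; apply: proper_card; apply/properP; split.
    apply/subsetP => f; rewrite !inE !negb_or => /andP[/andP[_]].
    rewrite negb_and negbK => /orP[/eqP-> gF'|-> ->//].
    by rewrite gF' in gF.
  by exists e; rewrite !inE ?eqxx // eH eF.
- apply/subsetP => f; rewrite !inE => /orP[/eqP->|/andP[_ /(subsetP HTF)]].
    by rewrite eF orbT.
  by rewrite inE.
- apply/subsetP => f fTF; rewrite !inE (subsetP TFH _ fTF) andbT orbC.
  by rewrite (contraNneq _ gF) // => <-; case/setIP: fTF.
move=> x; have := ubH x; have := deg_setD1 x gH.
rewrite deg_setU1 ?inE ?(negPf eH) ?andbF // E !inE.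
(* At [v] the new degree is at most [deg F v], which is within the bound because [m <= deg T v]. At
   [w] the edges [e] and [g] cancel. *)
have [->|_] /= := eqVneq x v; first by lia.
by have [->|_] := eqVneq x w; rewrite ?wg; lia.
Qed.

Lemma packing_with_degrees m T F : packing m T ->
  exists H, [/\ packing m H, H \subset T :|: F, forall v, deg F v <= deg H v
    & degree_bounded m T F H].
Proof.
move=> pT; have [n] := ubnP #|F|; elim: n F => // n IHn F Fn.
have [/existsP[e /existsP[v /existsP[w]]]|noedge] :=
  boolP [exists e, exists v, exists w, [&& e \in F :\: T,
    ends e == [set v; w], m < deg F v & m < deg F w]]; last first.
  apply: exchange_to_lower_bound => // e v w eFT E Fv; rewrite leqNgt.
  apply: contra noedge => Fw; apply/existsP; exists e; apply/existsP; exists v.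
  by apply/existsP; exists w; rewrite eFT E eqxx Fv.
case/and4P=> /setDP[eF eT] /eqP E Fv Fw.
have [|H [pH HTF lb ub]] := IHn (F :\ e).
  by move: Fn; rewrite (cardsD1 e) eF.
(* This is what the inclusion in [T :|: F] is carried for: the [H] built for [F :\ e] cannot already
   use [e]. *)
have eH : e \notin H.
  by apply: contra eT => /(subsetP HTF); rewrite !inE eqxx orbF.
exists (e |: H); split.
- exact: packing_subset (subsetUr _ _) pH.
- apply/subsetP => f; rewrite !inE => /orP[/eqP->|/(subsetP HTF)].
    by rewrite eF orbT.
  by rewrite !inE => /orP[->//|/andP[_ ->]]; rewrite orbT.
- by move=> x; rewrite deg_setU1 // (deg_setD1 x eF) leq_add2l.
- move=> x; have := ub x; have := deg_setD1 x eF; rewrite deg_setU1 // E !inE.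
  have [->|_] /= := eqVneq x v; first by lia.
  by have [->|_] := eqVneq x w; lia.
Qed.

End Packing.

Theorem theorem3p4 (G : mgraph) (m : nat) (m_gt0 : 0 < m) (T : factor G)
    (T_conn : tree_connected m T) (F : factor G) :
  exists H : factor G, tree_connected m H /\
    forall v : vertex G,
      deg F v <= deg H v /\ deg H v <= deg T v + maxn 0 (deg F v - m).
Proof.
have /tree_connectedP pT := T_conn.
have [H [pH _ lb ub]] := packing_with_degrees F pT.
exists H; split=> [|v]; first exact/tree_connectedP.
by rewrite max0n; split; [exact: lb | exact: ub].
Qed.
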